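(* Let $m\ge2$ be an integer and let $p^*$ be the (unique) solution $p\in[0,1/2]$, $p\neq 0$, of the equation $$1-\frac4m=(1-2p)\left(\frac{4}{mp}\Big(1-(1-p)^mS_{m-2}\big(p(1-p)^{m-2}\big)\Big)-1\right),$$ where $S_{m-2}(z)=\sum_{k=0}^{m-2}\frac{a_k}{k+1}z^k$ and $a_k$ is the number of subtrees with $k$ edges of the infinite $m$-regular tree that contain a fixed vertex. Then the erasure threshold of any sequence of proper $(2,m)$ CSS codes is at most $p^*$.
   Context: A binary matrix is of type $(2,m)$ if every row has weight $m$ and every column has weight $2$. Such a matrix is the incidence matrix of an $m$-regular graph: vertices are the rows, edges are the columns, and the column $j$ joins the two rows having a $1$ in column $j$ (parallel edges are allowed a priori). A $(2,m)$ CSS code of length $n$ is given by two binary matrices $\mathbf H_X,\mathbf H_Z$ with $n$ columns, both of type $(2,m)$, such that every row of $\mathbf H_X$ is orthogonal in $\mathbb F_2^n$ to every row of $\mathbf H_Z$. Let $G_X,G_Z$ be the associated graphs. The code is proper if $G_X$ and $G_Z$ are connected and both have girth (smallest cycle length) equal to $m$. As a stabilizer code: Pauli operators modulo phase on $n$ qubits are identified with pairs $(E_X,E_Z)\in\mathbb F_2^n\times\mathbb F_2^n$. The stabilizer group is $S=\operatorname{row}(\mathbf H_X)\times\operatorname{row}(\mathbf H_Z)$ and the syndrome of $E=(E_X,E_Z)$ is $\sigma(E)=(\mathbf H_Z\,{}^tE_X,\ \mathbf H_X\,{}^tE_Z)$. Quantum erasure channel of probability $p$: the erasure $\mathcal E\in\mathbb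 F_2^n$ is random with i.i.d. Bernoulli($p$) coordinates; given $\mathcal E$, the error $E=(E_X,E_Z)$ is uniform among pairs with both $E_X$ and $E_Z$ supported in the support of $\mathcal E$. The decoder sees $(\mathcal E,\sigma(E))$ and must determine the coset $E+S$. $P_{err}$ is the probability that the best possible estimate of $E+S$, as a function of $(\mathcal E,\sigma(E))$, is wrong. The erasure (decoding) threshold of a sequence of codes is the highest erasure probability tolerated with vanishing error probability, i.e. the supremum of the $p$ such that $P_{err}\to0$ along the sequence over the quantum erasure channel of probability $p$. *)

(* Defs.v *)
From mathcomp Require Import all_boot all_order all_algebra.
From mathcomp Require Import boolp classical_sets reals ereal topology
  normedtype sequences.

Set Implicit Arguments.
Unset Strict Implicit.
Unset Printing Implicit Defensive.

Import Order.TTheory GRing.Theory Num.Theory.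
Import numFieldNormedType.Exports.

Local Open Scope ring_scope.

(* A binary matrix H is seen as the incidence matrix of a multigraph with
   vertex set 'I_r (the rows) and edge set 'I_n (the columns). *)
Section IncidenceGraph.
Variables (r n : nat) (H : 'M['F_2]_(r, n)).

Definition type2 (m : nat) : Prop :=
  (forall i : 'I_r, #|[pred j | H i j == 1]| = m) /\
  (forall j : 'I_n, #|[pred i | H i j == 1]| = 2).

Definition joins (j : 'I_n) (u v : 'I_r) : bool :=
  [&& u != v, H u j == 1 & H v j == 1].

Definition adjacent : rel 'I_r := fun u v => [exists j, joins j u v].

Definition connected_graph : Prop :=
  (0 < r)%N /\ forall u v : 'I_r, connect adjacent u v.

(* The l vertices are pairwise distinct and so are the l edges; two parallel
   edges form a cycle of length 2.  [ordS] is the cyclic successor on 'I_l. *)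
Definition has_cycle (l : nat) : Prop :=
  (0 < l)%N /\
  exists (v : 'I_l -> 'I_r) (e : 'I_l -> 'I_n),
    [/\ injective v, injective e & forall i, joins (e i) (v i) (v (ordS i))].

Definition has_girth (g : nat) : Prop :=
  has_cycle g /\ forall l, has_cycle l -> (g <= l)%N.

End IncidenceGraph.

Record css_code := CssCode {
  len : nat;
  nbX : nat;
  nbZ : nat;
  HX : 'M['F_2]_(nbX, len);
  HZ : 'M['F_2]_(nbZ, len);
  HX_HZ_orthogonal : HX *m HZ^T = 0
}.

Definition css_type2 (m : nat) (C : css_code) : Prop :=
  type2 (HX C) m /\ type2 (HZ C) m.

Definition proper_css (m : nat) (C : css_code) : Prop :=
  [/\ css_type2 m C, connected_graph (HX C), connected_graph (HZ C),
      has_girth (HX C) m & has_girth (HZ C) m].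

Section Decoding.
Variables (R : realType) (C : css_code).

Local Notation bits := 'rV['F_2]_(len C).
Local Notation pauli := (bits * bits)%type.
Local Notation syndromes := ('cV['F_2]_(nbZ C) * 'cV['F_2]_(nbX C))%type.

Definition stabilizer (E : pauli) : bool :=
  (E.1 <= HX C)%MS && (E.2 <= HZ C)%MS.

Definition stab_coset (E : pauli) : {set pauli} :=
  finset (fun F : pauli => stabilizer (F - E)).

Definition syndrome (E : pauli) : syndromes :=
  (HZ C *m E.1^T, HX C *m E.2^T).

Definition supported (e : bits) (E : pauli) : bool :=
  [forall i, (e 0 i == 0) ==> (E.1 0 i == 0) && (E.2 0 i == 0)].

Definition erasure_prob (p : R) (e : bits) : R :=
  \prod_(i < len C) (if e 0 i == 1 then p else 1 - p).

Definition error_prob (e : bits) (E : pauli) : R :=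
  if supported e E then #|supported e|%:R^-1 else 0.

Definition decoder := {ffun bits * syndromes -> {set pauli}}.

Definition failure_prob (p : R) (D : decoder) : R :=
  \sum_(e : bits) \sum_(E : pauli | D (e, syndrome E) != stab_coset E)
    erasure_prob p e * error_prob e E.

(* Failure probabilities never exceed 1, so the default value 1 of the iterated
   minimum is harmless. *)
Definition Perr (p : R) : R :=
  \big[Order.min/1]_(D : decoder) failure_prob p D.

End Decoding.

Definition erasure_threshold (R : realType) (C : nat -> css_code) : R :=
  sup [set p : R | 0 <= p <= 1 /\
                   Perr (C i) p @[i --> \oo] --> (0 : R)]%classic.

(* The infinite m-regular tree is modelled as the Cayley graph of the free
   product of m copies of Z/2: its vertices are the words over 'I_m without two
   equal consecutive letters, and w is joined to the words i :: w. *)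
Definition tree_vertex (m : nat) (w : seq 'I_m) : bool :=
  sorted (fun i j => i != j) w.

Definition tree_adj (m : nat) (u v : seq 'I_m) : bool :=
  [&& tree_vertex u, tree_vertex v &
      ((u != [::]) && (behead u == v)) || ((v != [::]) && (behead v == u))].

(* (A, F) is a connected subgraph of the tree, with vertex set A containing the
   empty word and with k edges, an edge being the set of its two endpoints.
   Such a subgraph only visits words of length at most k, hence the finite type
   k.-bseq 'I_m. *)
Definition is_subtree (m k : nat)
    (T : {set k.-bseq 'I_m} * {set {set k.-bseq 'I_m}}) : bool :=
  let: (A, F) := T in
  [&& [bseq] \in A,
      [forall u in A, tree_vertex u],
      [forall f in F, exists u in A, exists v in A,
         tree_adj u v && (f == [set u; v])],
      [forall u in A, forall v in A,
         connect (fun x y => [set x; y] \in F) u v]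
    & #|F| == k].

Definition nb_subtrees (m k : nat) : nat := #|@is_subtree m k|.

Definition S_poly (R : realType) (m d : nat) (z : R) : R :=
  \sum_(k < d.+1) (nb_subtrees m k)%:R / k.+1%:R * z ^+ k.

(* Main.v *)
(** Let [E_q] be the expectation over a [q]-random erased set [A], let [s q] be
    the sum over X and Z of the expected ranks of the columns of [HX], [HZ] in
    [A], and let [k] be the code dimension.  The number [lam A] of independent
    X and Z logical operators supported in [A] is monotone in [A], satisfies
    [E_q lam = 2 q n - s 1 + s (1 - q) - s q] and [E_q lam <= 4 k Perr q]: when
    [lam A > 0], shifting errors by a logical operator defeats any decoder half
    of the time.  As matroid ranks are submodular, [s] is concave.  The rank
    of the random subgraph is the number of vertices minus the number of
    components; counting only the components that are trees with at most
    [m - 2] edges, which girth [m] makes locally indistinguishable from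
    subtrees of the regular tree, bounds [s] from above at [pstar].

    If [Perr p] is small for some [pstar < p < 1/2], then so is [E_q lam] at
    [q = p] and at [q = pstar].  Combining both bounds with concavity at the
    points [pstar, p, 1 - p, 1 - pstar, 1] contradicts the equation for
    [pstar].  Comparing with [k] rather than with [n] makes this work even when
    [1 - 4/m = 0], and uses no monotonicity of the right-hand side of the
    equation.  For [p >= 1/2], [E_q lam >= E_(1/2) lam = k] suffices. *)

Require Import Defs.
From mathcomp Require Import all_boot all_order all_algebra.
From mathcomp Require Import boolp classical_sets reals ereal topology
  normedtype sequences.
From mathcomp Require Import fintype finset fingroup perm fingraph.
From mathcomp Require Import ring lra zify.
Import Order.TTheory GRing.Theory Num.Theory.
Import numFieldNormedType.Exports.
Local Open Scope ring_scope.

Set Implicit Arguments.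
Unset Strict Implicit.
Unset Printing Implicit Defensive.

(** * Expectation over a random subset *)

Section RandomSubset.
Variables (R : realFieldType) (I : finType).
Implicit Types (p q t : R) (A B J : {set I}) (f g : {set I} -> R).

Definition subset_prob p A : R := \prod_i (if i \in A then p else 1 - p).

Definition expect p f : R := \sum_(A : {set I}) subset_prob p A * f A.

Lemma subset_prob_ge0 p A : 0 <= p <= 1 -> 0 <= subset_prob p A.
Proof. by move=> ?; apply: prodr_ge0 => i _; case: ifP => _; lra. Qed.

Lemma eq_expect p f g : f =1 g -> expect p f = expect p g.
Proof. by move=> fg; apply: eq_bigr => A _; rewrite fg. Qed.

Lemma le_expect p f g :
  0 <= p <= 1 -> (forall A, f A <= g A) -> expect p f <= expect p g.
Proof.
by move=> p01 fg; apply: ler_sum => A _; rewrite ler_wpM2l ?subset_prob_ge0.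
Qed.

Lemma expectD p f g : expect p (fun A => f A + g A) = expect p f + expect p g.
Proof. by rewrite -big_split; apply: eq_bigr => A _; rewrite mulrDr. Qed.

Lemma expectZ p (c : R) f : expect p (fun A => c * f A) = c * expect p f.
Proof. by rewrite /expect mulr_sumr; apply: eq_bigr => A _; rewrite mulrCA. Qed.

Lemma expect_sum p (K : finType) (P : pred K) (F : K -> {set I} -> R) :
  expect p (fun A => \sum_(k | P k) F k A) = \sum_(k | P k) expect p (F k).
Proof.
by rewrite exchange_big; apply: eq_bigr => A _; rewrite mulr_sumr.
Qed.

(** Product form of a cylinder event, which lets [bigA_distr] turn sums over subsets into products
    over elements. *)
Lemma setI_eq_prod A J B :
  ((A :&: J == B)%:R : R)
    = \prod_i (((i \in A) && (i \in J)) == (i \in B))%:R.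
Proof.
have [/setP eAB|nAB] := eqVneq.
  by rewrite big1 // => i _; rewrite -in_setI eAB eqxx.
have [i ni] : exists i, ((i \in A) && (i \in J)) != (i \in B).
  apply/existsP; apply: contraNT nAB => /existsPn e; apply/eqP/setP => i.
  by rewrite in_setI; apply/eqP; move: (e i); rewrite negbK.
by rewrite (bigD1 i) //= (negbTE ni) mul0r.
Qed.

Lemma expect_cylinder p J B : B \subset J ->
  expect p (fun A => (A :&: J == B)%:R) = p ^+ #|B| * (1 - p) ^+ #|J :\: B|.
Proof.
move=> sBJ.
transitivity (\prod_i ((if i \in B then p else 1)
                       * (if i \in J :\: B then 1 - p else 1))); last first.
  by rewrite big_split /= -!big_mkcond !prodr_const.
transitivity (\prod_i (p * ((i \in J) == (i \in B))%:R
                       + (1 - p) * (false == (i \in B))%:R)); last first.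
  apply: eq_bigr => i _; rewrite in_setD.
  by have := subsetP sBJ i; case: (i \in B); case: (i \in J) => //= h;
    [ring|have := h isT|ring|ring].
rewrite bigA_distr; apply: eq_bigr => A _.
rewrite setI_eq_prod -big_split /=; apply: eq_bigr => i _.
by case: (i \in A).
Qed.

Lemma expect1 p : expect p (fun=> 1) = 1.
Proof.
have := @expect_cylinder p set0 set0 (sub0set _).
rewrite setD0 cards0 !expr0 mulr1 => e; rewrite -[RHS]e; apply: eq_expect => A.
by rewrite setI0 eqxx.
Qed.

Lemma expect_cst p (c : R) : expect p (fun=> c) = c.
Proof.
by rewrite -[RHS]mulr1 -(expect1 p) -expectZ; apply: eq_expect => A; rewrite mulr1.
Qed.

Lemma expect_mem p i : expect p (fun A => (i \in A)%:R) = p.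
Proof.
have := @expect_cylinder p [set i] [set i] (subxx _).
rewrite setDv cards1 cards0 expr0 mulr1 expr1 => e; rewrite -[RHS]e; apply: eq_expect => A.
by congr (_%:R); rewrite setIC -sub1set; congr nat_of_bool; apply/setIidPl/eqP.
Qed.

Lemma expect_card p : expect p (fun A => #|A|%:R) = p * #|I|%:R.
Proof.
transitivity (expect p (fun A => \sum_i (i \in A)%:R)).
  by apply: eq_expect => A; rewrite -sum1_card natr_sum big_mkcond /=;
    apply: eq_bigr => i _; case: (i \in A).
rewrite (expect_sum _ _ (fun i A => (i \in A)%:R)).
rewrite (eq_bigr (fun=> p)) => [|i _]; last exact: expect_mem.
by rewrite sumr_const mulr_natr.
Qed.

(** An element survives two independent selections with probability [p * q]. Pairs are grouped by
    their intersection [D], whose total weight factors over the elements. *)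
Lemma expect_setI p q f :
  expect p (fun A => expect q (fun B => f (A :&: B))) = expect (p * q) f.
Proof.
pose w A B D := subset_prob p A * (subset_prob q B * (A :&: B == D)%:R).
transitivity (\sum_(D : {set I}) (\sum_(A : {set I}) \sum_(B : {set I}) w A B D) * f D).
  under [RHS]eq_bigr do rewrite mulr_suml.
  rewrite exchange_big; apply: eq_bigr => A _.
  under [RHS]eq_bigr do rewrite mulr_suml.
  rewrite exchange_big mulr_sumr; apply: eq_bigr => B _.
  rewrite (bigD1 (A :&: B)) //= big1 ?addr0 => [|D nD].
    by rewrite /w eqxx mulr1 !mulrA.
  by rewrite /w eq_sym (negbTE nD) !mulr0 mul0r.
apply: eq_bigr => D _; congr (_ * _).
transitivity (\sum_(A : {set I}) \prod_i
   (if i \in A then p * (q * (true == (i \in D))%:R + (1 - q) * (false == (i \in D))%:R)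
    else (1 - p) * (false == (i \in D))%:R)).
  apply: eq_bigr => A _; rewrite -mulr_sumr.
  transitivity (subset_prob p A * \prod_i
     (q * ((i \in A) == (i \in D))%:R + (1 - q) * (false == (i \in D))%:R)).
    congr (_ * _); rewrite bigA_distr; apply: eq_bigr => B _.
    rewrite setI_eq_prod -big_split /=; apply: eq_bigr => i _.
    by case: (i \in A); case: (i \in B).
  rewrite -big_split /=; apply: eq_bigr => i _.
  by case: (i \in A) => //; congr (_ * _); rewrite -mulrDl subrKC mul1r.
rewrite -bigA_distr; apply: eq_bigr => i _.
by case: (i \in D) => /=; ring.
Qed.

Lemma expect_setC p f : expect p (fun A => f (~: A)) = expect (1 - p) f.
Proof.
rewrite /expect (reindex_inj (inv_inj (@setCK I))); apply: eq_bigr => A _.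
rewrite setCK; congr (_ * _); apply: eq_bigr => i _.
by rewrite in_setC; case: (i \in A) => //=; rewrite opprB subrKC.
Qed.

Lemma expect_setU p q f :
  expect p (fun A => expect q (fun B => f (A :|: B)))
    = expect (1 - (1 - p) * (1 - q)) f.
Proof.
rewrite -expect_setC -expect_setI -(expect_setC p).
apply: eq_expect => A; rewrite -(expect_setC q).
by apply: eq_expect => B; rewrite setCI !setCK.
Qed.

(** Coupling: keeping each element of a [q]-random set with probability [p / q] gives a [p]-random
    subset of it. *)
Lemma expect_homo p q f : 0 <= p <= q -> q <= 1 ->
  (forall A B, A \subset B -> f A <= f B) -> expect p f <= expect q f.
Proof.
move=> /andP[p0 pq] q1 fmono.
have [q0|q0] := eqVneq q 0.
  by have -> : p = q by lra.
have qp : 0 < q by rewrite lt_neqAle eq_sym q0; lra.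
have -> : p = q * (p / q) by rewrite mulrC divfK.
rewrite -expect_setI; apply: le_expect => [|A]; first by lra.
rewrite -[leRHS](expect_cst (p / q)); apply: le_expect => [|B].
  by rewrite divr_ge0 ?(ltW qp) //= ler_pdivrMr ?mul1r.
exact/fmono/subsetIl.
Qed.

(** As [x] may lie in [D], this form of diminishing returns also makes [f] nondecreasing. *)
Definition submodular f := forall (A D : {set I}) x,
  A \subset D -> f (x |: D) - f D <= f (x |: A) - f A.

Lemma submodularD f g :
  submodular f -> submodular g -> submodular (fun A => f A + g A).
Proof.
move=> sf sg A D x sAD; have := sf A D x sAD; have := sg A D x sAD; lra.
Qed.

(* Elements of [D] are added one at a time; the marginal gain over [A :&: D'],
   given that the new element lies in [A], is at least the gain over [D']. *)
Lemma expect_submodular_ge t f : 0 <= t <= 1 -> submodular f ->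
  (1 - t) * f set0 + t * f [set: I] <= expect t f.
Proof.
move=> t01 fsub.
suff H : forall D, (1 - t) * f set0 + t * f D <= expect t (fun A => f (A :&: D)).
  by apply: le_trans (H _) _; apply: le_expect => // A; rewrite setIT.
move=> D; have [n] := ubnP #|D|; elim: n D => // n IHn D.
have [->|[x xD]] := set_0Vmem D => [_|].
  under eq_expect do rewrite setI0.
  by rewrite expect_cst -mulrDl subrK mul1r.
rewrite (cardsD1 x) xD ltnS => /IHn H.
pose D' := D :\ x.
apply: (@le_trans _ _ (expect t (fun A => f (A :&: D')) + t * (f D - f D'))).
  by have := H; rewrite -/D'; lra.
have -> : t * (f D - f D') = expect t (fun A => (f D - f D') * (x \in A)%:R).
  by rewrite expectZ expect_mem mulrC.
rewrite -expectD; apply: le_expect => // A.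
have -> : D = x |: D' by rewrite setD1K.
have [xA|xA] := boolP (x \in A).
  have := fsub (A :&: D') D' x (subsetIr _ _).
  have -> : A :&: (x |: D') = x |: (A :&: D').
    by rewrite setIUr; congr (_ :|: _); apply/setIidPr; rewrite sub1set.
  by move=> h; rewrite /= mulr1n; lra.
rewrite /= mulr0n mulr0 addr0 setIUr [A :&: [set x]](_ : _ = set0) ?set0U //.
by apply/setP => y; rewrite !inE; apply/andP => -[yA /eqP e]; rewrite e (negbTE xA) in yA.
Qed.

(** For each [A], the preceding bound applies to [fun B => f (A :|: B)], and the union of the two
    random sets is again random. This is concavity along the chord from [p] to 1. *)
Lemma expect_submodular_concave p t f : 0 <= p <= 1 -> 0 <= t <= 1 ->
  submodular f ->
  (1 - t) * expect p f + t * f [set: I] <= expect (1 - (1 - p) * (1 - t)) f.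
Proof.
move=> p01 t01 fsub; rewrite -expect_setU.
rewrite -expectZ -[t * _](expect_cst p) -expectD; apply: le_expect => // A.
have subA : submodular (fun B => f (A :|: B)).
  by move=> B D x sBD; rewrite ![A :|: (x |: _)]setUCA; apply/fsub/setUS.
by have := expect_submodular_ge t01 subA; rewrite setU0 setUT.
Qed.

End RandomSubset.

(** * Ranks of column submatrices *)

Section CoordinateSubspaces.
Variables (F : fieldType) (n : nat).
Implicit Types (A B : {set 'I_n}).

(** It has two roles: its row space consists of the vectors supported in [A], and right
    multiplication by it clears the columns outside [A]. *)
Definition coord_mx A : 'M[F]_n := diag_mx (\row_i (i \in A)%:R).

Lemma mul_coord_mxE r (U : 'M_(r, n)) A i j :
  (U *m coord_mx A) i j = if j \in A then U i j else 0.
Proof. by rewrite mul_mx_diag !mxE; case: ifP; rewrite ?mulr1 ?mulr0. Qed.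

Lemma sub_coord_mx (x : 'rV[F]_n) A :
  (x <= coord_mx A)%MS = [forall i, (i \notin A) ==> (x 0 i == 0)].
Proof.
apply/idP/forallP => [/submxP[y ->] i|h].
  by apply/implyP => /negbTE iA; rewrite mul_coord_mxE iA.
suff -> : x = x *m coord_mx A by apply: submxMl.
apply/rowP => i; rewrite mul_coord_mxE; case: ifPn => // iA.
by apply/eqP; have := h i; rewrite iA.
Qed.

Lemma coord_mxS A B : A \subset B -> (coord_mx A <= coord_mx B)%MS.
Proof.
move=> sAB; apply/rV_subP => x; rewrite !sub_coord_mx => /forallP h.
apply/forallP => i; apply/implyP => iB; apply: (implyP (h i)).
by apply: contraNN iB; apply/subsetP.
Qed.

Lemma coord_mxI A B : (coord_mx A :&: coord_mx B :=: coord_mx (A :&: B))%MS.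
Proof.
apply/eqmxP/andP; split; last first.
  by rewrite sub_capmx !coord_mxS ?subsetIl ?subsetIr.
apply/rV_subP => x; rewrite sub_capmx !sub_coord_mx => /andP[/forallP hA /forallP hB].
apply/forallP => i; rewrite in_setI negb_and.
by apply/implyP => /orP[]; [apply: (implyP (hA i))|apply: (implyP (hB i))].
Qed.

Lemma ker_coord_mx A : (kermx (coord_mx A) :=: coord_mx (~: A))%MS.
Proof.
apply/eqmxP/andP; split; apply/rV_subP => x;
  rewrite sub_coord_mx (sameP sub_kermxP eqP).
- move=> /eqP/rowP h; apply/forallP => i; rewrite in_setC negbK.
  by apply/implyP => iA; have := h i; rewrite mul_coord_mxE iA mxE => ->.
- move=> /forallP h; apply/eqP/rowP => i; rewrite mul_coord_mxE mxE.
  by case: ifP => // iA; have := h i; rewrite in_setC negbK iA => /eqP.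
Qed.

(** Only the lower bound is shown directly; for [A] and [~: A] together it is tight, as the two
    ranks add up to [n]. *)
Lemma rank_coord_mx A : \rank (coord_mx A) = #|A|.
Proof.
have le B : (#|B| <= \rank (coord_mx B))%N.
  pose P := \matrix_(i < #|B|, j < n) (enum_val i == j)%:R : 'M[F]_(_, _).
  apply: (@mulmx1_min_rank _ _ _ _ _ P P^T); apply/matrixP => i j; rewrite !mxE.
  rewrite (bigD1 (enum_val j)) //= big1 => [|l nl]; last first.
    by rewrite [P^T _ _]mxE [P _ _]mxE eq_sym (negbTE nl) mulr0.
  rewrite mul_coord_mxE enum_valP !mxE eqxx mulr1 addr0.
  by rewrite (inj_eq enum_val_inj).
have := rank_leq_row (coord_mx A); have := mxrank_ker (coord_mx A).
rewrite ker_coord_mx; have := le A; have := le (~: A).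
by have := cardsC A; rewrite card_ord; lia.
Qed.

(** The dimension of the row space shortened to the words supported in [A]. *)
Definition cap_dim r (U : 'M[F]_(r, n)) A := \rank (U :&: coord_mx A)%MS.

(** The rank function of the column matroid of [U]. *)
Definition col_rank r (U : 'M[F]_(r, n)) A := \rank (U *m coord_mx A).

(** Rank-nullity for the projection of the row space onto the coordinates in [A]. *)
Lemma col_rank_cap r (U : 'M_(r, n)) A :
  (col_rank U A + cap_dim U (~: A) = \rank U)%N.
Proof.
rewrite -(mxrank_mul_ker U (coord_mx A)); congr addn.
by apply: eqmx_rank; apply/eqmxP/cap_eqmx => //; apply: eqmx_sym; apply: ker_coord_mx.
Qed.

Lemma ker_cap_dim r (U : 'M_(r, n)) A :
  (col_rank U A + cap_dim (kermx U^T) A = #|A|)%N.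
Proof.
rewrite -rank_coord_mx -(mxrank_mul_ker _ U^T); congr addn.
  by rewrite -mxrank_tr trmx_mul trmxK tr_diag_mx.
by rewrite /cap_dim capmxC.
Qed.

(** Writing [K_A] for the part of [K] supported in [A]: the sum of [K_A] and [S_B] lies in [K_B],
    their intersection in [S_A]. *)
Lemma cap_dim_relative r s (K : 'M_(r, n)) (S : 'M_(s, n)) A B :
  (S <= K)%MS -> A \subset B ->
  (cap_dim K A + cap_dim S B <= cap_dim K B + cap_dim S A)%N.
Proof.
move=> sSK sAB; rewrite /cap_dim -mxrank_sum_cap leq_add ?mxrankS //.
  by rewrite addsmx_sub !capmxS ?coord_mxS.
rewrite sub_capmx.
apply/andP; split; [apply: submx_trans (capmxSr _ _) _|apply: submx_trans (capmxSl _ _) _].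
  exact: capmxSl.
exact: capmxSr.
Qed.

Lemma cap_dim_supermodular r (U : 'M_(r, n)) A B :
  (cap_dim U A + cap_dim U B <= cap_dim U (A :|: B) + cap_dim U (A :&: B))%N.
Proof.
rewrite /cap_dim -mxrank_sum_cap leq_add ?mxrankS //.
  by rewrite addsmx_sub !capmxS ?coord_mxS ?subsetUl ?subsetUr.
rewrite -(cap_eqmx (eqmx_refl U) (coord_mxI A B)) !sub_capmx.
rewrite (submx_trans (capmxSl _ _) (capmxSl _ _)).
rewrite (submx_trans (capmxSl _ _) (capmxSr _ _)).
by rewrite (submx_trans (capmxSr _ _) (capmxSr _ _)).
Qed.

Lemma col_rank0 r (U : 'M_(r, n)) : col_rank U set0 = 0%N.
Proof.
apply/eqP; rewrite mxrank_eq0; apply/eqP/matrixP => i j.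
by rewrite mul_coord_mxE in_set0 mxE.
Qed.

Lemma col_rankT r (U : 'M_(r, n)) : col_rank U [set: 'I_n] = \rank U.
Proof.
by congr (\rank _); apply/matrixP => i j; rewrite mul_coord_mxE in_setT.
Qed.

(** Supermodularity of [cap_dim] at [~: (x |: A)] and [~: D], carried over to complements by
    [col_rank_cap]. If [x] lies in [D], monotonicity is enough. *)
Lemma col_rank_submodular (R : realFieldType) r (U : 'M_(r, n)) :
  submodular (fun A => (col_rank U A)%:R : R).
Proof.
move=> A D x sAD.
have [xD|xD] := boolP (x \in D).
  rewrite [x |: D](setUidPr _) ?sub1set // subrr subr_ge0 ler_nat.
  have eA := col_rank_cap U A; have eA' := col_rank_cap U (x |: A).
  have : (cap_dim U (~: (x |: A)) <= cap_dim U (~: A))%N.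
    by rewrite mxrankS // capmxS // coord_mxS // setCS subsetUr.
  lia.
have := cap_dim_supermodular U (~: (x |: A)) (~: D).
have -> : ~: (x |: A) :|: ~: D = ~: A.
  rewrite -setCI; congr (~: _); rewrite setIUl (setIidPl sAD).
  rewrite [_ :&: D](_ : _ = set0) ?set0U //.
  by apply/setP => y; rewrite !inE; apply/andP => -[/eqP -> h]; rewrite h in xD.
have -> : ~: (x |: A) :&: ~: D = ~: (x |: D).
  by rewrite -setCU -setUA (setUidPr sAD).
have := col_rank_cap U A; have := col_rank_cap U D.
have := col_rank_cap U (x |: A); have := col_rank_cap U (x |: D).
move=> e1 e2 e3 e4 h; rewrite lerBlDr addrAC lerBrDr -!natrD ler_nat; lia.
Qed.

End CoordinateSubspaces.

(** * Decoding over the erasure channel *)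

Section ErasureDecoding.
Variables (R : realType) (C : css_code).
Local Notation n := (len C).
Local Notation bits := 'rV['F_2]_n.
Implicit Types (A B : {set 'I_n}) (e : bits).

(* X and Z logical operators are counted together: the value at [setT] is twice
   the number of logical qubits. *)
Definition logical_dim A : R :=
  (cap_dim (kermx (HZ C)^T) A)%:R - (cap_dim (HX C) A)%:R
  + ((cap_dim (kermx (HX C)^T) A)%:R - (cap_dim (HZ C) A)%:R).

Lemma HX_sub_ker : (HX C <= kermx (HZ C)^T)%MS.
Proof. exact/sub_kermxP/HX_HZ_orthogonal. Qed.

Lemma HZ_sub_ker : (HZ C <= kermx (HX C)^T)%MS.
Proof.
by apply/sub_kermxP; rewrite -[HZ C]trmxK -trmx_mul HX_HZ_orthogonal trmx0.
Qed.

(** Rank-nullity turns each kernel term into [#|A|] minus a rank on [A], and each stabilizer term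
    into a total rank minus a rank on [~: A]. *)
Lemma logical_dimE A : logical_dim A = 2 * #|A|%:R
  - ((col_rank (HX C) A)%:R + (col_rank (HZ C) A)%:R)
  - ((\rank (HX C))%:R + (\rank (HZ C))%:R)
  + ((col_rank (HX C) (~: A))%:R + (col_rank (HZ C) (~: A))%:R).
Proof.
have arith (a fX fZ gX gZ rX rZ kX kZ dX dZ : nat) :
    (fX + kX = a)%N -> (fZ + kZ = a)%N -> (gX + dX = rX)%N -> (gZ + dZ = rZ)%N ->
    kZ%:R - dX%:R + (kX%:R - dZ%:R)
      = 2 * a%:R - (fX%:R + fZ%:R) - (rX%:R + rZ%:R) + (gX%:R + gZ%:R) :> R.
  move=> <- e <- <-; have -> : (fX + kX)%:R = (fZ + kZ)%:R :> R by rewrite e.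
  by move/(congr1 (fun k => k%:R : R)): e; rewrite !natrD; lra.
have := col_rank_cap (HX C) (~: A); have := col_rank_cap (HZ C) (~: A).
rewrite setCK => eZ eX.
exact: (arith _ _ _ _ _ _ _ _ _ _ _ (ker_cap_dim _ _) (ker_cap_dim _ _) eX eZ).
Qed.

Lemma logical_dim_homo A B : A \subset B -> logical_dim A <= logical_dim B.
Proof.
move=> sAB; apply: lerD.
  have := cap_dim_relative HX_sub_ker sAB.
  by rewrite -(ler_nat R) !natrD; lra.
have := cap_dim_relative HZ_sub_ker sAB.
by rewrite -(ler_nat R) !natrD; lra.
Qed.

(** One of the two differences is positive, so some kernel vector supported in [A] is outside the
    row space; it is paired with 0. *)
Lemma logical_operator A : 0 < logical_dim A ->
  exists L : bits * bits,
    [/\ ~~ stabilizer L, syndrome L = 0,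
        (L.1 <= coord_mx _ A)%MS & (L.2 <= coord_mx _ A)%MS].
Proof.
have nsub r s (K : 'M['F_2]_(r, n)) (S : 'M_(s, n)) :
    (cap_dim S A < cap_dim K A)%N ->
    exists x : bits, [/\ (x <= K)%MS, (x <= coord_mx _ A)%MS & ~~ (x <= S)%MS].
  rewrite ltnNge => h.
  have : ~~ (K :&: coord_mx _ A <= S :&: coord_mx _ A)%MS.
    by apply: contraNN h; apply: mxrankS.
  case/row_subPn => i; rewrite sub_capmx => hi.
  have := row_sub i (K :&: coord_mx 'F_2 A)%MS.
  rewrite sub_capmx => /andP[xK xA]; exists (row i (K :&: coord_mx _ A)%MS).
  by split => //; rewrite xA andbT in hi.
move=> lpos.
have [hX|hX] := ltnP (cap_dim (HX C) A) (cap_dim (kermx (HZ C)^T) A).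
  have [x [xK xA xS]] := nsub _ _ _ _ hX.
  exists (x, 0); split => //=; rewrite ?sub0mx //.
    by rewrite /stabilizer /= (negbTE xS).
  rewrite /syndrome /= trmx0 mulmx0; congr (_, _).
  by apply: trmx_inj; rewrite trmx_mul trmxK trmx0; apply/sub_kermxP.
have hZ : (cap_dim (HZ C) A < cap_dim (kermx (HX C)^T) A)%N.
  rewrite ltnNge; apply/negP => hZ; move: lpos; apply/negP; rewrite -leNgt.
  by rewrite -[leRHS](addr0 0) lerD // subr_le0 ler_nat.
have [x [xK xA xS]] := nsub _ _ _ _ hZ.
exists (0, x); split => //=; rewrite ?sub0mx //.
  by rewrite /stabilizer /= (negbTE xS) andbF.
rewrite /syndrome /= trmx0 mulmx0; congr (_, _).
by apply: trmx_inj; rewrite trmx_mul trmxK trmx0; apply/sub_kermxP.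
Qed.

Definition erased e : {set 'I_n} := [set i | e 0 i == 1].

Lemma erased_bij : bijective erased.
Proof.
exists (fun A => \row_i (i \in A)%:R) => [e|A].
  apply/rowP => i; rewrite mxE inE.
  by case: (e 0 i) => [[|[|k]] hk] //=; apply/val_inj.
by apply/setP => i; rewrite inE mxE; case: (i \in A).
Qed.

Lemma F2_eq0 (x : 'F_2) : (x == 0) = (x != 1).
Proof. by case: x => [[|[|]]]. Qed.

Lemma supportedE e (E : bits * bits) :
  supported e E = (E.1 <= coord_mx _ (erased e))%MS && (E.2 <= coord_mx _ (erased e))%MS.
Proof.
rewrite !sub_coord_mx; apply/forallP/andP => [h|[/forallP h1 /forallP h2] i].
  by split; apply/forallP => i; have := h i; rewrite F2_eq0 inE;
    case: (_ != 1) => //= /andP[].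
have := h1 i; have := h2 i; rewrite F2_eq0 inE.
by case: (_ != 1) => //= -> ->.
Qed.

Lemma sum_error_prob e : \sum_E error_prob R e E = 1.
Proof.
rewrite -big_mkcond sumr_const -[LHS]mulr_natr mulVf //.
rewrite pnatr_eq0 -lt0n; apply/card_gt0P; exists (0, 0).
have h : supported e (0, 0) by rewrite supportedE !sub0mx.
exact: h.
Qed.

(** For a logical operator [L] supported in the erasure, [E] and [E + L] are equally likely and have
    the same syndrome but different cosets, so every decoder fails on at least one of them. *)
Lemma failure_ge e (D : decoder C) : 0 < logical_dim (erased e) ->
  1 / 2 <= \sum_(E | D (e, syndrome E) != stab_coset E) error_prob R e E.
Proof.
move=> /logical_operator[L [nL synL L1 L2]].
have shift (E : bits * bits) : error_prob R e (E + L) = error_prob R e E.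
  rewrite /error_prob !supportedE /=.
  have addL (x y : bits) (V : 'M['F_2]_n) : (y <= V)%MS -> ((x + y)%R <= V)%MS = (x <= V)%MS.
    move=> yV; apply/idP/idP => h; last exact: addmx_sub.
    by rewrite -(addrK y x); apply: addmx_sub => //; rewrite eqmx_opp.
  by rewrite !addL.
have synE (E : bits * bits) : syndrome (E + L) = syndrome E.
  by move: synL; rewrite /syndrome /= => -[h1 h2]; rewrite !raddfD /= h1 h2 !addr0.
pose fail (E : bits * bits) : R :=
  if D (e, syndrome E) != stab_coset E then error_prob R e E else 0.
rewrite big_mkcond [X in _ <= X](_ : _ = \sum_E fail E) //.
suff : \sum_E error_prob R e E
    <= \sum_(E : bits * bits) fail E + \sum_(E : bits * bits) fail (E + L).
  have -> : \sum_(E : bits * bits) fail (E + L) = \sum_E fail E.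
    rewrite [RHS](reindex (fun E : bits * bits => E + L)) //.
    by exists (fun E => E - L) => E _; rewrite ?addrK ?subrK.
  by rewrite sum_error_prob; lra.
rewrite -big_split; apply: ler_sum => E _; rewrite /fail /=.
have e0 : 0 <= error_prob R e E.
  by rewrite /error_prob; case: ifP => // _; rewrite invr_ge0.
rewrite synE shift.
have [eD|_] /= := eqVneq (D (e, syndrome E)) (stab_coset E); last by case: ifP; lra.
have [eD'|_] /= := eqVneq (D (e, syndrome E)) (stab_coset (E + L)); last by lra.
case/negP: nL; have := congr1 (fun S : {set _} => E + L \in S) (etrans (esym eD) eD').
rewrite !inE subrr [E + L - E]addrAC subrr add0r => ->.
by rewrite /stabilizer !sub0mx.
Qed.

Lemma Perr_ge (p : R) : 0 <= p <= 1 ->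
  expect p (fun A => (0 < logical_dim A)%R%:R) / 2 <= Perr C p.
Proof.
move=> p01.
apply: (big_ind (fun x => expect p (fun A => (0 < logical_dim A)%R%:R) / 2 <= x)).
(* The default value 1 of the minimum must satisfy the bound as well. *)
- suff : expect p (fun A => (0 < logical_dim A)%R%:R) <= 1 by lra.
  rewrite -[leRHS](expect1 'I_n p); by apply: le_expect => // A; rewrite lern1 leq_b1.
- by move=> x y hx hy; rewrite le_min hx.
move=> D _; rewrite /failure_prob /expect mulr_suml (reindex erased) /=; last first.
  exact/onW_bij/erased_bij.
apply: ler_sum => e _; rewrite -mulr_sumr -mulrA.
have -> : subset_prob p (erased e) = erasure_prob p e.
  by apply: eq_bigr => i _; rewrite inE.
apply: ler_wpM2l.
  by apply: prodr_ge0 => i _; case: ifP => _; lra.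
have [/(failure_ge D)|_] // := boolP (0 < logical_dim (erased e)).
by rewrite mul0r sumr_ge0 // => E _; rewrite /error_prob; case: ifP => // _; rewrite invr_ge0.
Qed.

Definition code_dim : R := n%:R - (\rank (HX C))%:R - (\rank (HZ C))%:R.

(** By monotonicity [logical_dim] never exceeds its value [2 * code_dim] on the full set, and
    [Perr_ge] bounds the probability that it is positive. *)
Lemma expect_logical_dim_le_Perr (p : R) : 0 <= p <= 1 ->
  expect p logical_dim <= 4 * code_dim * Perr C p.
Proof.
move=> p01.
have logical_dimT : logical_dim [set: 'I_n] = 2 * code_dim.
  by rewrite logical_dimE setCT !col_rank0 !col_rankT cardsT card_ord /code_dim; lra.
have logical_dim0 : logical_dim set0 = 0.
  by rewrite logical_dimE setC0 !col_rank0 !col_rankT cards0; lra.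
have dim_ge0 : 0 <= code_dim.
  by have := logical_dim_homo (sub0set [set: 'I_n]); rewrite logical_dimT logical_dim0; lra.
pose X := expect p (fun A => (0 < logical_dim A)%R%:R : R).
have hX : X / 2 <= Perr C p := Perr_ge p01.
apply: (@le_trans _ _ (2 * code_dim * X)); last first.
  have hX0 : 0 <= Perr C p - X / 2 by rewrite subr_ge0.
  have := mulr_ge0 dim_ge0 hX0.
  lra.
rewrite /X -expectZ; apply: le_expect => // A.
case: ltP => hA; last by rewrite mulr0.
by rewrite mulr1 -logical_dimT logical_dim_homo ?subsetT.
Qed.

Definition rank_sum A : R := (col_rank (HX C) A)%:R + (col_rank (HZ C) A)%:R.

Lemma expect_logical_dim (p : R) : expect p logical_dim =
  2 * p * n%:R - rank_sum [set: 'I_n] + expect (1 - p) rank_sum - expect p rank_sum.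
Proof.
have gen (f : {set 'I_n} -> R) (c : R) :
    expect p (fun A => 2 * #|A|%:R - f A - c + f (~: A))
      = 2 * p * n%:R - c + expect (1 - p) f - expect p f.
  transitivity (expect p (fun A => (2 * #|A|%:R + (-1) * f A) + (- c + f (~: A)))).
    by apply: eq_expect => A; rewrite mulN1r addrA.
  rewrite (expectD p _ (fun A => - c + f (~: A))) expectD expectD !expectZ.
  by rewrite expect_cst expect_card card_ord expect_setC; lra.
rewrite -gen; apply: eq_expect => A.
by rewrite logical_dimE /rank_sum !col_rankT.
Qed.

End ErasureDecoding.

(** * Covering an incidence graph by the regular tree *)

Section GraphCovering.
Variables (r n m : nat) (H : 'M['F_2]_(r, n)).
Hypotheses (row_deg : forall i : 'I_r, #|[pred j | H i j == 1]| = m)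
           (col_deg : forall j : 'I_n, #|[pred i | H i j == 1]| = 2).
Implicit Types (u v : 'I_r) (e j : 'I_n) (w x : seq 'I_m) (s : seq (seq 'I_m)).

Lemma joins_sym e u v : joins H e u v = joins H e v u.
Proof. by rewrite /joins eq_sym [X in _ && X]andbC. Qed.

Lemma joins_ends e u v u' : joins H e u v -> H u' e == 1 -> u' = u \/ u' = v.
Proof.
case/and3P => uv ue ve u'e.
have : [set u; v] == [set i | H i e == 1].
  by rewrite eqEcard cards2 uv cardsE col_deg andbT subUset !sub1set !inE ue ve.
by move=> /eqP/setP/(_ u'); rewrite !inE u'e => /orP[]/eqP; [left|right].
Qed.

(** The default [u] is never returned when [e] is incident to [u]. *)
Definition opposite e u := odflt u [pick v | joins H e v u].

Lemma opposite_joins e u : H u e == 1 -> joins H e (opposite e u) u.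
Proof.
move=> ue; rewrite /opposite; case: pickP => //= no.
have : [set i | H i e == 1] \subset [set u].
  apply/subsetP => v; rewrite !inE => ve; apply: contraT => vu.
  by have := no v; rewrite /joins vu ve ue.
by move/subset_leq_card; rewrite cardsE col_deg cards1.
Qed.

Definition nth_edge u (i : 'I_m) : 'I_n :=
  enum_val (cast_ord (esym (row_deg u)) i).

Lemma nth_edgeP u i : H u (nth_edge u i) == 1.
Proof. exact: (enum_valP (cast_ord (esym (row_deg u)) i)). Qed.

Lemma nth_edge_inj u : injective (nth_edge u).
Proof. by move=> i j /enum_val_inj/cast_ord_inj. Qed.

Lemma nth_edge_surj u e : H u e == 1 -> exists i, nth_edge u i == e.
Proof.
move=> ue; exists (cast_ord (row_deg u) (enum_rank_in (A := [pred j | H u j == 1]) ue e)).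
by rewrite /nth_edge cast_ord_comp cast_ord_id enum_rankK_in.
Qed.

(* The second component relabels the edges at the current vertex so that the
   edge just traversed carries the last letter; reduced words then correspond
   exactly to the walks from [v] that never turn back. *)
Fixpoint cover v w : ('I_r * {perm 'I_m})%type :=
  if w is i :: w' then
    let: (u, f) := cover v w' in
    let u' := opposite (nth_edge u (f i)) u in
    (u', tperm i (odflt i [pick k | nth_edge u' k == nth_edge u (f i)]))
  else (v, 1%g).

Definition cover_vertex v w := (cover v w).1.

Definition cover_edge v w i := nth_edge (cover_vertex v w) ((cover v w).2 i).

Lemma cover_edge_inj v w : injective (cover_edge v w).
Proof. by move=> i j /nth_edge_inj/perm_inj. Qed.

Lemma cover_vertex_cons v i w :
  cover_vertex v (i :: w) = opposite (cover_edge v w i) (cover_vertex v w).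
Proof. by rewrite /cover_edge /cover_vertex /=; case: cover. Qed.

Lemma cover_edge_joins v w i :
  joins H (cover_edge v w i) (cover_vertex v (i :: w)) (cover_vertex v w).
Proof. by rewrite cover_vertex_cons opposite_joins // nth_edgeP. Qed.

(** The transposition in [cover] serves this purpose: repeating a letter amounts to turning back. *)
Lemma cover_edge_back v w i : cover_edge v (i :: w) i = cover_edge v w i.
Proof.
have /and3P[_ inc _] := cover_edge_joins v w i.
move: inc; rewrite {2 3}/cover_edge /cover_vertex /=.
rewrite {1}/cover_edge /cover_vertex /=; case: (cover v w) => u f /= inc.
rewrite tpermL; case: pickP => [k /eqP|no] //=.
by have [k] := nth_edge_surj inc; rewrite no.
Qed.

(** At a closest repetition the vertices in between are distinct. So are the edges: one used twice
    would give a closer repetition or two equal consecutive edges. *)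
Lemma nonbacktracking_cycle (vs : nat -> 'I_r) (es : nat -> 'I_n) N a b :
  (forall t, (t < N)%N -> joins H (es t) (vs t) (vs t.+1)) ->
  (forall t, (t.+1 < N)%N -> es t != es t.+1) ->
  (a < b <= N)%N -> vs a = vs b ->
  exists2 l, (l <= N)%N & has_cycle H l.
Proof.
move=> wj wnb; have [d] := ubnP (b - a); elim: d a b => // d IHd a b lbd abN eab.
have [/existsP[i /existsP[j /and5P[ai lij jb nab /eqP vij]]]|nex] := boolP
  [exists i : 'I_N.+1, exists j : 'I_N.+1,
    [&& (a <= i)%N, (i < j)%N, (j <= b)%N, (j - i < b - a)%N & vs i == vs j]].
  by apply: (IHd i j) => //; lia.
have inj (i j : nat) : (a <= i)%N -> (i < j)%N -> (j <= b)%N -> (j - i < b - a)%N ->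
    vs i = vs j -> False.
  move=> ai lij jb lt eij; case/negP: nex.
  have iN : (i < N.+1)%N by lia.
  have jN : (j < N.+1)%N by lia.
  by apply/existsP; exists (Ordinal iN); apply/existsP; exists (Ordinal jN);
    rewrite /= eij eqxx lt ai lij jb.
exists (b - a)%N; first by lia.
split; first by lia.
exists (fun i => vs (a + i)%N), (fun i => es (a + i)%N); split.
- move=> i j /= e; apply/val_inj => /=; apply/eqP; rewrite eqn_leq.
  have := ltn_ord i; have := ltn_ord j; move=> hj hi.
  apply/andP; split; rewrite leqNgt; apply/negP => lt.
    by apply: (inj (a + j)%N (a + i)%N) => //; lia.
  by apply: (inj (a + i)%N (a + j)%N) => //; lia.
- have esinj (i j : nat) : (i < j)%N -> (j < b - a)%N -> es (a + i)%N = es (a + j)%N -> False.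
    move=> lij ljb e.
    have ji : joins H (es (a + i)%N) (vs (a + i)%N) (vs (a + i).+1) by apply: wj; lia.
    have jj : joins H (es (a + i)%N) (vs (a + j)%N) (vs (a + j).+1).
      by rewrite e; apply: wj; lia.
    have /and3P[_ inc _] := jj.
    case: (joins_ends ji inc) => [e1|e1].
      by apply: (inj (a + i)%N (a + j)%N) => //; lia.
    have [ej|nj] := eqVneq (a + i).+1 (a + j)%N.
      have lt : ((a + i).+1 < N)%N by lia.
      by have := wnb _ lt; rewrite ej e eqxx.
    by apply: (inj (a + i).+1 (a + j)%N) => //; lia.
  move=> i j /= e; apply/val_inj => /=; apply/eqP; rewrite eqn_leq.
  apply/andP; split; rewrite leqNgt; apply/negP => lt.
    by apply: (esinj j i).
  by apply: (esinj i j).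
(* At the last index [ordS] wraps around to 0, and [vs a = vs b] closes the cycle. *)
- move=> i; have -> : vs (a + ordS i)%N = vs (a + i).+1.
    rewrite /=; have := ltn_ord i; rewrite leq_eqVlt => /orP[/eqP e|lt].
      by rewrite e modnn addn0 eab; congr vs; lia.
    by rewrite modn_small // addnS.
  by apply: wj; have := ltn_ord i; lia.
Qed.

(** * Small subtrees embed under the girth condition *)

Hypothesis girth_ge : forall l, has_cycle H l -> (m <= l)%N.
Variable i0 : 'I_m.

(** The edge towards the parent; [i0] is only the default of [head] at the empty word, where the
    value carries no meaning. *)
Definition up_edge v w := cover_edge v (behead w) (head i0 w).

Lemma up_edge_joins v w : w != [::] ->
  joins H (up_edge v w) (cover_vertex v w) (cover_vertex v (behead w)).
Proof. by case: w => // i w _; apply: cover_edge_joins. Qed.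

Lemma tree_adjP w x : tree_adj w x ->
  exists i, (w = i :: x /\ tree_vertex (i :: x)) \/ (x = i :: w /\ tree_vertex (i :: w)).
Proof.
case/and3P => tw tx /orP[]/andP[].
  by case: w tw => // i w tw _ /eqP/= <-; exists i; left.
by case: x tx => // i x tx _ /eqP/= <-; exists i; right.
Qed.

Definition adj_edge v w x :=
  if (size x < size w)%N then up_edge v w else up_edge v x.

Lemma adj_edge_joins v w x : tree_adj w x ->
  joins H (adj_edge v w x) (cover_vertex v w) (cover_vertex v x).
Proof.
case/tree_adjP => i [[-> _]|[-> _]]; rewrite /adj_edge /= ?ltnSn ?ltnNge ?leqnSn /=.
  exact: cover_edge_joins.
by rewrite joins_sym; apply: cover_edge_joins.
Qed.

(** Seen from [x], the two edges carry different letters, and [cover_edge] is injective in the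
    letter; [cover_edge_back] names an edge from its other end. *)
Lemma adj_edge_neq v w x y : tree_adj w x -> tree_adj x y -> w != y ->
  adj_edge v w x != adj_edge v x y.
Proof.
case/tree_adjP => i [[-> t1]|[-> t1]].
- case/tree_adjP => j [[ex t2]|[-> t2]]; rewrite /adj_edge.
    rewrite ex in t1 *.
    rewrite /= !ltnSn /up_edge /= -(cover_edge_back v y j).
    by rewrite (inj_eq (@cover_edge_inj _ _)); case/andP: t1.
  rewrite /= ltnSn ltnNge leqnSn /up_edge /= (inj_eq (@cover_edge_inj _ _)).
  by apply: contraNN => /eqP ->.
case/tree_adjP => j [[[_ ->] _]|[-> t2]]; first by rewrite eqxx.
rewrite /adj_edge /= !ltnNge !leqnSn /up_edge /= -(cover_edge_back v w i).
by move=> _; rewrite (inj_eq (@cover_edge_inj _ _)) eq_sym; case/andP: t2.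
Qed.

(* Finite subtrees of the [m]-regular tree that contain the root, given by
   their vertices. *)
Definition word_tree s :=
  [&& [::] \in s, uniq s, all (@tree_vertex m) s
    & all (fun w => behead w \in s) s].

Section WordTree.
Variables (v : 'I_r) (s : seq (seq 'I_m)).
Hypothesis tree_s : word_tree s.

Lemma word_tree_root : [::] \in s. Proof. by case/and4P: tree_s. Qed.
Lemma word_tree_uniq : uniq s. Proof. by case/and4P: tree_s. Qed.
Lemma word_tree_reduced w : w \in s -> tree_vertex w.
Proof. by case/and4P: tree_s => _ _ /allP h _; apply: h. Qed.
Lemma word_tree_behead w : w \in s -> behead w \in s.
Proof. by case/and4P: tree_s => _ _ _ /allP h; apply: h. Qed.

Lemma word_tree_adj i w : i :: w \in s -> tree_adj (i :: w) w && tree_adj w (i :: w).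
Proof.
move=> iw; have w_s := word_tree_behead iw.
by rewrite /tree_adj !(word_tree_reduced iw) !(word_tree_reduced w_s) /= eqxx orbT.
Qed.

Lemma path_to_root w : w \in s ->
  exists p, [/\ path (@tree_adj m) w p, last w p = [::] & {subset p <= s}].
Proof.
elim: w => [|i w IHw] iw; first by exists [::].
have w_s := word_tree_behead iw.
have [p [pp lp ps]] := IHw w_s; exists (w :: p); split => //=.
  by rewrite pp andbT; case/andP: (word_tree_adj iw).
by move=> x; rewrite inE => /predU1P[->|/ps].
Qed.

Lemma path_from_root w : w \in s ->
  exists p, [/\ path (@tree_adj m) [::] p, last [::] p = w & {subset p <= s}].
Proof.
elim: w => [|i w IHw] iw; first by exists [::].
have w_s := word_tree_behead iw.
have [p [pp lp ps]] := IHw w_s; exists (rcons p (i :: w)); split.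
- by rewrite rcons_path pp lp; case/andP: (word_tree_adj iw).
- by rewrite last_rcons.
- by move=> x; rewrite mem_rcons inE => /predU1P[->|/ps].
Qed.

Lemma uniq_tree_path w x : w \in s -> x \in s ->
  exists p, [/\ path (@tree_adj m) w p, last w p = x, uniq (w :: p)
               & {subset w :: p <= s}].
Proof.
move=> ws xs; have [p [pp lp ps]] := path_to_root ws.
have [q [pq lq qs]] := path_from_root xs.
have : path (@tree_adj m) w (p ++ q) by rewrite cat_path pp lp pq.
have : last w (p ++ q) = x by rewrite last_cat lp.
move=> lpq ppq; case: (shortenP ppq) lpq => p' pp' up' sp' lp'.
exists p'; split => // y; rewrite inE => /predU1P[->//|/sp'].
by rewrite mem_cat => /orP[/ps|/qs].
Qed.

Hypothesis small_s : (size s < m)%N.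

(** A repetition-free tree path between two words with the same image projects to a closed walk
    without turning back, hence yields a cycle shorter than [m]. *)
Lemma cover_vertex_inj : {in s &, injective (cover_vertex v)}.
Proof.
move=> w x ws xs ewx; apply/eqP; apply: contraT => nwx.
have [p [pp lp up ps]] := uniq_tree_path ws xs.
have psize : (size (w :: p) <= size s)%N by apply: uniq_leq_size.
pose q t := nth [::] (w :: p) t.
have qadj t : (t < size p)%N -> tree_adj (q t) (q t.+1).
  by move=> lt; apply: (pathP [::] pp).
have [] := @nonbacktracking_cycle (fun t => cover_vertex v (q t))
    (fun t => adj_edge v (q t) (q t.+1)) (size p) 0 (size p).
- by move=> t /qadj/(adj_edge_joins v).
- move=> t lt; apply: adj_edge_neq; [by apply: qadj; lia|exact: qadj|].
  by rewrite /q nth_uniq //= ?ltnS; lia.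
- by rewrite leqnn andbT; case: p lp {pp up ps psize q qadj} => //= e; rewrite e eqxx in nwx.
- by rewrite /q /= ewx -lp (last_nth [::]).
by move=> l lp' /girth_ge; move: psize => /=; lia.
Qed.

(** By injectivity [w] is [x] or its parent; if it were [x], then [i] would be its first letter and
    [i :: w] not reduced. *)
Lemma cover_edge_up w i x : w \in s -> x \in s -> x != [::] ->
  tree_vertex (i :: w) -> cover_edge v w i = up_edge v x -> i :: w = x.
Proof.
case: x => // j z ws jzs _ tiw e; have zs := word_tree_behead jzs.
have jz := cover_edge_joins v z j.
have /and3P[_ _ inc] := cover_edge_joins v w i.
move: inc; rewrite e => inc; case: (joins_ends jz inc) => eq.
  have ew : w = j :: z by apply: cover_vertex_inj.
  move: e; rewrite /up_edge /= -(cover_edge_back v z j) -ew => /cover_edge_inj ij.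
  by move: tiw; rewrite ew ij /tree_vertex /= eqxx.
have ew : w = z by apply: cover_vertex_inj.
by move: e; rewrite /up_edge /= ew => /cover_edge_inj ->.
Qed.

(** * Occurrence of a small tree around a vertex *)

Definition tree_edges : {set 'I_n} :=
  [set e in [seq up_edge v w | w <- s & w != [::]]].

Definition tree_vertices : {set 'I_r} := [set u in [seq cover_vertex v w | w <- s]].

Definition star_edges : {set 'I_n} :=
  [set e | [exists u in tree_vertices, H u e == 1]].

Lemma tree_edgesP e :
  reflect (exists2 w, w \in s & w != [::] /\ e = up_edge v w) (e \in tree_edges).
Proof.
rewrite inE; apply: (iffP mapP) => [[w]|[w ws [w0 ->]]].
  by rewrite mem_filter => /andP[w0 ws] ->; exists w.
by exists w; rewrite ?mem_filter ?w0.
Qed.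

Lemma tree_verticesP u :
  reflect (exists2 w, w \in s & u = cover_vertex v w) (u \in tree_vertices).
Proof. by rewrite inE; apply: mapP. Qed.

Lemma star_edgesP e :
  reflect (exists2 w, w \in s & H (cover_vertex v w) e == 1) (e \in star_edges).
Proof.
rewrite inE; apply: (iffP exists_inP) => [[u /tree_verticesP[w ws ->] we]|[w ws we]].
  by exists w.
by exists (cover_vertex v w) => //; apply/tree_verticesP; exists w.
Qed.

Lemma up_edge_inj : {in [seq w <- s | w != [::]] &, injective (up_edge v)}.
Proof.
move=> w x; rewrite !mem_filter => /andP[w0 ws] /andP[x0 xs].
case: w w0 ws => // i w _ iws; apply: cover_edge_up => //.
  exact: word_tree_behead iws.
exact: word_tree_reduced.
Qed.

Lemma card_tree_edges : #|tree_edges|.+1 = size s.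
Proof.
rewrite cardsE (card_uniqP _) ?size_map; last first.
  by rewrite map_inj_in_uniq ?filter_uniq ?word_tree_uniq //; apply: up_edge_inj.
rewrite size_filter -[RHS](count_predC (pred1 [::])).
by rewrite (count_uniq_mem _ word_tree_uniq) word_tree_root.
Qed.

Lemma card_tree_vertices : #|tree_vertices| = size s.
Proof.
rewrite cardsE (card_uniqP _) ?size_map //.
by rewrite map_inj_in_uniq ?word_tree_uniq //; apply: cover_vertex_inj.
Qed.

Lemma tree_edges_sub_star : tree_edges \subset star_edges.
Proof.
apply/subsetP => e /tree_edgesP[w ws [w0 ->]]; apply/star_edgesP; exists w => //.
by case/and3P: (up_edge_joins v w0).
Qed.

(** Double count of incidences with the tree vertices: a tree edge has two, any other star edge at
    least one. *)
Lemma card_star_edges : (#|star_edges :\: tree_edges| + 2 * #|tree_edges| <= size s * m)%N.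
Proof.
have -> : (size s * m = \sum_e \sum_(u in tree_vertices) (H u e == 1%R))%N.
  rewrite exchange_big /= -card_tree_vertices -sum_nat_const.
  by apply: eq_bigr => u _; rewrite -(row_deg u) -sum1_card big_mkcond.
have -> : (#|star_edges :\: tree_edges| + 2 * #|tree_edges|
    = \sum_e ((e \in star_edges :\: tree_edges) + 2 * (e \in tree_edges)))%N.
  rewrite big_split /= -big_distrr /= -!sum1_card.
  by congr (_ + 2 * _)%N; rewrite big_mkcond.
apply: leq_sum => e _; rewrite in_setD.
have [/tree_edgesP[w ws [w0 ->]]|_] /= := boolP (e \in tree_edges).
  have /and3P[neq inc1 inc2] := up_edge_joins v w0.
  have in1 : cover_vertex v w \in tree_vertices by apply/tree_verticesP; exists w.
  have in2 : cover_vertex v (behead w) \in tree_vertices.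
    by apply/tree_verticesP; exists (behead w) => //; apply: word_tree_behead.
  have in2' : (cover_vertex v (behead w) \in tree_vertices)
      && (cover_vertex v (behead w) != cover_vertex v w) by rewrite in2 eq_sym.
  rewrite (bigD1 (cover_vertex v w)) //= (bigD1 (cover_vertex v (behead w))) //=.
  by rewrite inc1 inc2 addnA leq_addr.
rewrite muln0 addn0; case: (boolP (e \in star_edges)) => // /star_edgesP[w ws inc].
have inw : cover_vertex v w \in tree_vertices by apply/tree_verticesP; exists w.
by rewrite (bigD1 _ inw) /= inc.
Qed.

Definition edge_adj (A : {set 'I_n}) : rel 'I_r := fun u u' =>
  [exists e in A, joins H e u u'].

(* The hypothesis says that the random subgraph restricted to the edges meeting
   the tree is exactly the tree. *)
Lemma component_sub_tree (A : {set 'I_n}) : A :&: star_edges = tree_edges ->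
  (#|connect (edge_adj A) v| <= size s)%N.
Proof.
move=> ev; rewrite -card_tree_vertices; apply: subset_leq_card; apply/subsetP => u.
rewrite unfold_in => /connectP[p pp ->].
have : v \in tree_vertices by apply/tree_verticesP; exists [::]; rewrite ?word_tree_root.
elim: p (v) pp => //= u1 p IHp u0 /andP[/exists_inP[e eA ju] pp] /tree_verticesP[w ws eu0].
apply: IHp => //.
have : e \in tree_edges.
  rewrite -ev in_setI eA; apply/star_edgesP; exists w => //.
  by rewrite -eu0; case/and3P: ju.
move=> /tree_edgesP[x xs [x0 ex]]; rewrite ex in ju.
have /and3P[_ _ inc] := ju.
apply/tree_verticesP; case: (joins_ends (up_edge_joins v x0) inc) => ->.
  by exists x.
by exists (behead x) => //; apply: word_tree_behead.
Qed.

Lemma tree_event_prob (R : realFieldType) (p : R) : 0 <= p <= 1 ->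
  p ^+ (size s).-1 * (1 - p) ^+ (size s * m - 2 * (size s).-1) <=
  expect p (fun A => (A :&: star_edges == tree_edges)%:R).
Proof.
move=> p01; rewrite expect_cylinder ?tree_edges_sub_star //.
have et : #|tree_edges| = (size s).-1 by rewrite -card_tree_edges.
rewrite et.
apply: ler_wpM2l; first by rewrite exprn_ge0 //; lra.
(* As [1 - p <= 1], an upper bound on the exponent bounds the power from below. *)
apply: ler_wiXn2l; [lra|lra|].
have := card_star_edges; rewrite et addnC => h.
by rewrite leq_subRL // (leq_trans (leq_addr _ _) h).
Qed.

End WordTree.

(** By induction on words: the edge to [i :: w] is in [A] and meets the tree of [s'], so it is an
    edge of that tree. Used both ways, this shows that at most one tree occurs at [v]. *)
Lemma tree_event_sub v s s' (A : {set 'I_n}) :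
  word_tree s -> (size s < m)%N -> word_tree s' -> (size s' < m)%N ->
  A :&: star_edges v s = tree_edges v s -> A :&: star_edges v s' = tree_edges v s' ->
  {subset s <= s'}.
Proof.
move=> ts ss ts' ss' ev ev'; elim=> [_|i w IHw iws]; first exact: word_tree_root.
have ws' := IHw (word_tree_behead ts iws).
have : cover_edge v w i \in tree_edges v s'.
  rewrite -ev' in_setI; apply/andP; split; last first.
    by apply/star_edgesP; exists w => //; case/and3P: (cover_edge_joins v w i).
  have : cover_edge v w i \in tree_edges v s by apply/tree_edgesP; exists (i :: w).
  by rewrite -ev in_setI => /andP[].
case/tree_edgesP => x xs' [x0 e].
by rewrite (cover_edge_up ts' ss' ws' xs' x0 _ e) // (word_tree_reduced ts iws).
Qed.

End GraphCovering.

(** * Rank and connected components *)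

Section RankComponents.
Variables (r n : nat) (H : 'M['F_2]_(r, n)).
Hypothesis col_deg : forall j : 'I_n, #|[pred i | H i j == 1]| = 2.
Variable A : {set 'I_n}.
Local Notation adj := (edge_adj H A).

Lemma edge_adj_sym : connect_sym adj.
Proof.
apply: sym_connect_sym => u v; apply: eq_existsb => e.
by rewrite joins_sym.
Qed.

(** The vertices of each component contribute 1 in total. *)
Lemma sum_inv_component (R : realFieldType) :
  \sum_(v : 'I_r) (#|connect adj v|%:R^-1 : R) = #|roots adj|%:R.
Proof.
rewrite (partition_big (root adj) (roots adj)) => [|v _]; last first.
  exact: (roots_root edge_adj_sym).
rewrite -sum1_card natr_sum; apply: eq_bigr => x /eqP rx /=.
have eqr v : (root adj v == x) = connect adj x v.
  by rewrite -{1}rx (root_connect edge_adj_sym) edge_adj_sym.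
rewrite (eq_bigr (fun=> #|connect adj x|%:R^-1)) => [|v]; last first.
  rewrite eqr => xv; congr (_%:R^-1); apply: eq_card => u.
  exact/esym/(same_connect edge_adj_sym xv).
rewrite sumr_const (eq_card (B := connect adj x)) => [|v]; last exact: eqr.
rewrite -[LHS]mulr_natl mulfV // pnatr_eq0 -lt0n; apply/card_gt0P; exists x.
exact: connect0.
Qed.

(* The indicator vectors of the components are independent elements of the
   left kernel. *)
Lemma rank_components : (#|roots adj| + col_rank H A <= r)%N.
Proof.
pose P : 'M['F_2]_(#|roots adj|, r) := \matrix_(i, u) (connect adj (enum_val i) u)%:R.
pose Q : 'M['F_2]_(r, #|roots adj|) := \matrix_(u, i) (u == enum_val i)%:R.
have PQ : 1%:M *m P *m Q = 1%:M.
  rewrite mul1mx; apply/matrixP => i j; rewrite !mxE.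
  rewrite (bigD1 (enum_val j)) //= big1 => [|u nu]; last first.
    by rewrite [Q _ _]mxE (negbTE nu) mulr0.
  rewrite !mxE eqxx mulr1 addr0 -(root_connect edge_adj_sym).
  have /eqP -> : roots adj (enum_val i) by exact: (enum_valP i).
  have /eqP -> : roots adj (enum_val j) by exact: (enum_valP j).
  by rewrite (inj_eq enum_val_inj).
have P0 : P *m (H *m coord_mx _ A) = 0.
  apply/matrixP => i j; rewrite mxE [RHS]mxE.
  have [jA|jA] := boolP (j \in A); last first.
    by rewrite big1 // => u _; rewrite mul_coord_mxE (negbTE jA) mulr0.
  (* The two ends of an edge in [A] lie in the same component, so their entries cancel modulo 2. *)
  have /eqP/cards2P[a [b [nab /setP ends]]] : #|[set u | H u j == 1]| = 2.
    by rewrite cardsE col_deg.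
  have Ha : H a j = 1 by apply/eqP; have := ends a; rewrite !inE eqxx.
  have Hb : H b j = 1 by apply/eqP; have := ends b; rewrite !inE eqxx orbT.
  rewrite (bigD1 a) //= (bigD1 b) 1?eq_sym //= big1 => [|u /andP[ua ub]]; last first.
    have := ends u; rewrite !inE (negbTE ua) (negbTE ub) /= => /negbT.
    by rewrite -F2_eq0 mul_coord_mxE jA => /eqP ->; rewrite mulr0.
  rewrite !mul_coord_mxE jA Ha Hb !mxE !mulr1 addr0.
  have -> : connect adj (enum_val i) b = connect adj (enum_val i) a.
    apply/esym/(same_connect1r edge_adj_sym); apply/exists_inP; exists j => //.
    by rewrite /joins nab Ha Hb.
  by case: (connect _ _ a); apply/val_inj.
by apply: leq_trans (mulmx0_rank_max P0); rewrite leq_add2r (mulmx1_min_rank PQ).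
Qed.

End RankComponents.

Lemma rank_incidence_lt r n (H : 'M['F_2]_(r, n)) :
  (forall j : 'I_n, #|[pred i | H i j == 1]| = 2) -> (0 < r)%N ->
  (\rank H < r)%N.
Proof.
case: r H => // r H col_deg _.
have := rank_components col_deg [set: 'I_n]; rewrite col_rankT.
have : (0 < #|roots (edge_adj H [set: 'I_n])|)%N.
  apply/card_gt0P; exists (root (edge_adj H [set: 'I_n]) ord0).
  exact: (roots_root (edge_adj_sym _ _)).
lia.
Qed.

(** * Subtrees of the regular tree *)

Section Subtrees.
Variables m k : nat.
Local Notation word := (k.-bseq 'I_m).
Implicit Types (T : {set word} * {set {set word}}) (u v w : word).

Definition subtree_words T : seq (seq 'I_m) := [seq val u | u <- enum T.1].

Lemma mem_subtree_words T u : (val u \in subtree_words T) = (u \in T.1).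
Proof. by rewrite mem_map ?mem_enum //; apply: val_inj. Qed.

Section Subtree.
Variable T : {set word} * {set {set word}}.
Hypothesis subT : is_subtree T.

Lemma subtree_edge u v : [set u; v] \in T.2 -> [/\ u \in T.1, v \in T.1 & tree_adj u v].
Proof.
case: T subT => A F /and5P[_ _ /forall_inP edges _ _] /edges.
case/exists_inP => x xA /exists_inP[y yA /andP[xy /eqP exy]].
have yx : tree_adj y x by move: xy; rewrite /tree_adj andbCA orbC.
have nxy : x != y.
  apply: contraTneq xy => ->; rewrite /tree_adj orbb.
  case: (val y) => [|a w] /=; rewrite ?andbF //.
  by apply/negP => /and3P[_ _ /eqP/(congr1 size)] /=; lia.
move/setP: exy => ext.
have := ext x; have := ext y; have := ext u; have := ext v.
rewrite !inE !eqxx !orbT /= => /esym hv /esym hu.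
by case/orP: hv => /eqP ->; case/orP: hu => /eqP ->;
  rewrite ?orbb ?(negbTE nxy) ?[y == x]eq_sym ?(negbTE nxy).
Qed.

(** The default of [insubd] is never reached, as [behead] does not lengthen a word; the root is its
    own parent. *)
Definition parent u : word := insubd u (behead u).

Lemma val_parent u : val (parent u) = behead u.
Proof. by rewrite insubdK // unfold_in size_behead (leq_trans (leq_pred _)) ?size_bseq. Qed.

(** The descendants of [u] are the words with suffix [u]. A path to the root has to leave them,
    which only the edge from [u] to its parent allows. *)
Lemma subtree_parent u : u \in T.1 -> val u != [::] -> [set u; parent u] \in T.2.
Proof.
move=> uT u0; have : connect (fun x y => [set x; y] \in T.2) u [bseq].
  case: T subT uT => A F /and5P[rA _ _ conn _] uA.
  by move/forall_inP: conn => /(_ u uA)/forall_inP; apply.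
case/connectP => p pp /esym lp.
suff step q x : path (fun x y => [set x; y] \in T.2) x q -> last x q = [bseq] ->
    suffix (val u) (val x) -> [set u; parent u] \in T.2.
  exact: step pp lp (suffix_refl _).
elim: q x {pp lp} => [|y q IHq] x /=; first by move=> _ ->; rewrite suffixs0 (negbTE u0).
case/andP => xy pp lp sux; have [_ yT /and3P[_ _ txy]] := subtree_edge xy.
have [suy|nsuy] := boolP (suffix (val u) (val y)); first exact: (IHq y).
case/orP: txy => /andP[n0 /eqP eb]; last first.
  have [i ey] : exists i, bseqval y = i :: bseqval x.
    by case: (bseqval y) n0 eb => //= i w _ <-; exists i.
  by case/negP: nsuy; rewrite [val y]ey -cat1s suffix_catr.
have ux : val u = val x.
  case/suffixP: sux => -[|i t] ex; first by rewrite [RHS]ex.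
  by case/negP: nsuy; apply/suffixP; exists t; rewrite -[LHS]eb [bseqval x]ex.
have -> : u = x by apply: val_inj.
suff -> : parent x = y by [].
by apply: val_inj; rewrite val_parent.
Qed.

(** The vertices thus determine the subtree, and the edges correspond to the non-root vertices. *)
Lemma subtree_edgesE :
  T.2 = [set [set u; parent u] | u in [set u in T.1 | val u != [::]]].
Proof.
apply/setP => f; apply/idP/imsetP => [fT|[u]]; last first.
  by rewrite inE => /andP[uT u0] ->; apply: subtree_parent.
have : exists u v, f = [set u; v].
  case: T subT fT => A F /and5P[_ _ /forall_inP edges _ _] /= /edges.
  by case/exists_inP => x _ /exists_inP[y _ /andP[_ /eqP ->]]; exists x, y.
case=> u [v ef]; rewrite ef in fT *.
have [uT vT /and3P[_ _ /orP[]/andP[n0 /eqP eb]]] := subtree_edge fT.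
  exists u; first by rewrite inE uT.
  by congr [set _; _]; apply: val_inj; rewrite val_parent.
exists v; first by rewrite inE vT.
by rewrite setUC; congr [set _; _]; apply: val_inj; rewrite val_parent.
Qed.

Lemma parent_edge_inj :
  {in [set u in T.1 | val u != [::]] &, injective (fun u => [set u; parent u])}.
Proof.
move=> u v; rewrite !inE => /andP[_ u0] /andP[_ v0] /setP e.
have := e u; have := e v; rewrite !inE !eqxx /= => /orP[/eqP //|/eqP evu].
case/esym/orP => /eqP // euv.
have := val_parent u; have := val_parent v; rewrite -evu -euv => -> e1.
have : size (val v) = (size (val v)).-2 by rewrite -!size_behead -e1.
by case: (val v) v0 => // i [|j w] _ /= ; lia.
Qed.

Lemma size_subtree_words : size (subtree_words T) = k.+1.
Proof.
rewrite size_map -cardE.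
have cardF : #|T.2| = k by case: T subT => A F /and5P[_ _ _ _ /eqP].
have rT : [bseq] \in T.1 by case: T subT => A F /and5P[].
transitivity #|T.2|.+1; last by rewrite cardF.
rewrite subtree_edgesE (card_in_imset parent_edge_inj).
rewrite (cardsD1 [bseq]) rT add1n; congr _.+1; apply: eq_card => u.
by rewrite !inE andbC.
Qed.

Lemma subtree_words_tree : word_tree (subtree_words T).
Proof.
apply/and4P; split.
- rewrite -[[::]]/(val ([bseq] : word)) mem_subtree_words.
  by case: T subT => A F /and5P[].
- by rewrite map_inj_uniq ?enum_uniq //; apply: val_inj.
- apply/allP => w /mapP[u]; rewrite mem_enum => uT ->.
  by case: T subT uT => A F /and5P[_ /forall_inP h _ _ _] /h.
apply/allP => w /mapP[u]; rewrite mem_enum => uT ->.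
rewrite -val_parent mem_subtree_words.
have [u0|u0] := eqVneq (val u) [::]; last first.
  by have [] := subtree_edge (subtree_parent uT u0).
suff -> : parent u = u by [].
by apply: val_inj; rewrite val_parent u0.
Qed.

End Subtree.

Lemma subtree_words_inj T T' : is_subtree T -> is_subtree T' ->
  subtree_words T =i subtree_words T' -> T = T'.
Proof.
move=> sT sT' e; have e1 : T.1 = T'.1.
  by apply/setP => u; rewrite -!mem_subtree_words e.
have e2 : T.2 = T'.2 by rewrite (subtree_edgesE sT) (subtree_edgesE sT') e1.
by case: T T' {sT sT' e} e1 e2 => A F [A' F'] /= -> ->.
Qed.

End Subtrees.

(** * Upper bound on the expected rank *)

Section ExpectedRank.
Variables (R : realType) (r n m : nat) (H : 'M['F_2]_(r, n)).
Hypotheses (m_gt1 : (1 < m)%N)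
           (row_deg : forall i : 'I_r, #|[pred j | H i j == 1]| = m)
           (col_deg : forall j : 'I_n, #|[pred i | H i j == 1]| = 2)
           (girth_ge : forall l, has_cycle H l -> (m <= l)%N).

Let i0 : 'I_m := Ordinal (ltnW m_gt1).

Let occurs v (k : nat) T (A : {set 'I_n}) : bool :=
  A :&: star_edges row_deg v (@subtree_words m k T)
    == tree_edges row_deg i0 v (subtree_words T).

(** The cut-off [m - 2] keeps the number [k + 1] of vertices below the girth. *)
Let small (k : 'I_(m - 2).+1) T :
  @is_subtree m k T -> (size (subtree_words T) < m)%N.
Proof. by move=> sT; rewrite size_subtree_words //; have := ltn_ord k; lia. Qed.

(** At most one subtree occurs, so at most one term [1 / (k + 1)] is nonzero, and then the component
    of [v] has at most [k + 1] vertices. *)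
Lemma component_count_ge v (A : {set 'I_n}) :
  \sum_(k < (m - 2).+1) \sum_(T | @is_subtree m k T)
      k.+1%:R^-1 * (occurs v T A)%:R
    <= (#|connect (edge_adj H A) v|%:R^-1 : R).
Proof.
have [/existsP[k /existsP[T /andP[sT occ]]]|none] :=
  boolP [exists k : 'I_(m - 2).+1, exists T, @is_subtree m k T && occurs v T A];
  last first.
  rewrite big1 ?invr_ge0 // => k _; rewrite big1 // => T sT.
  have -> : occurs v T A = false; last by rewrite mulr0.
  by apply: contraNF none => occ; apply/existsP; exists k; apply/existsP;
    exists T; rewrite sT.
have same (k' : 'I_(m - 2).+1) T' : @is_subtree m k' T' -> occurs v T' A ->
    subtree_words T' =i subtree_words T.
  move=> sT' occ' w; apply/idP/idP; move: w.
    by apply: (tree_event_sub col_deg girth_ge (subtree_words_tree sT') (small sT')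
      (subtree_words_tree sT) (small sT) (eqP occ') (eqP occ)).
  by apply: (tree_event_sub col_deg girth_ge (subtree_words_tree sT) (small sT)
      (subtree_words_tree sT') (small sT') (eqP occ) (eqP occ')).
rewrite (bigD1 k) //= [X in _ + X]big1 => [|k' nk]; last first.
  rewrite big1 // => T' sT'.
  have -> : occurs v T' A = false; last by rewrite mulr0.
  apply: contraNF nk => /(same _ _ sT') e; apply/eqP/val_inj/succn_inj.
  rewrite -(size_subtree_words sT) -(size_subtree_words sT').
  apply/perm_size/uniq_perm => //; apply: word_tree_uniq; exact: subtree_words_tree.
rewrite (bigD1 T) //= [X in _ + X + _]big1 => [|T' /andP[sT' nT]]; last first.
  have -> : occurs v T' A = false; last by rewrite mulr0.
  by apply: contraNF nT => /(same _ _ sT')/(subtree_words_inj sT' sT)->.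
rewrite occ mulr1 !addr0 -(size_subtree_words sT) lef_pV2 ?posrE ?ltr0n.
- rewrite ler_nat.
  exact: (component_sub_tree col_deg girth_ge (subtree_words_tree sT) (small sT) (eqP occ)).
- by rewrite size_subtree_words.
by apply/card_gt0P; exists v; apply: connect0.
Qed.

Lemma expect_rank_le (p : R) : 0 <= p <= 1 ->
  expect p (fun A => (col_rank H A)%:R)
    <= r%:R * (1 - (1 - p) ^+ m * S_poly m (m - 2) (p * (1 - p) ^+ (m - 2))).
Proof.
move=> p01.
pose comps (A : {set 'I_n}) : R := \sum_(v : 'I_r) #|connect (edge_adj H A) v|%:R^-1.
have le_comps A : (col_rank H A)%:R <= r%:R - comps A.
  rewrite /comps (sum_inv_component _ _ R) // lerBrDr -natrD ler_nat addnC.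
  exact: rank_components.
apply: le_trans (le_expect p01 le_comps) _.
rewrite (expectD p (fun=> r%:R) (fun A => - comps A)) expect_cst.
rewrite (eq_expect p (g := fun A => -1 * comps A)) => [|A]; last by rewrite mulN1r.
rewrite expectZ mulN1r mulrBr mulr1 lerD2l lerN2.
rewrite (expect_sum p xpredT (fun v A => #|connect (edge_adj H A) v|%:R^-1)).
set q := 1 - p; set z := p * q ^+ (m - 2).
apply: (@le_trans _ _ (\sum_(v : 'I_r) q ^+ m * S_poly m (m - 2) z)).
  by rewrite sumr_const card_ord mulr_natl.
apply: ler_sum => v _; apply: le_trans (le_expect p01 (component_count_ge v)).
rewrite (expect_sum p xpredT (fun (k : 'I_(m - 2).+1) A =>
  \sum_(T | @is_subtree m k T) k.+1%:R^-1 * (occurs v T A)%:R)).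
rewrite /S_poly mulr_sumr; apply: ler_sum => k _.
rewrite (expect_sum p (@is_subtree m k) (fun T A => k.+1%:R^-1 * (occurs v T A)%:R)).
apply: (@le_trans _ _ (\sum_(T | @is_subtree m k T)
    k.+1%:R^-1 * (p ^+ k * q ^+ (k.+1 * m - 2 * k)))).
  rewrite sumr_const -[_ *+ _]mulr_natl /nb_subtrees.
  (* This form of the exponent splits off [q ^+ m] and leaves [z ^+ k]. *)
  have -> : (k.+1 * m - 2 * k = m + (m - 2) * k)%N by nia.
  by rewrite exprD exprM exprMn le_eqVlt; apply/orP; left; apply/eqP; ring.
apply: ler_sum => T sT; rewrite expectZ ler_wpM2l ?invr_ge0 //.
have := tree_event_prob row_deg col_deg girth_ge i0 v (subtree_words_tree sT) (small sT) p01.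
by rewrite size_subtree_words.
Qed.

End ExpectedRank.

(** * Bounds for a proper code *)

Section ProperCode.
Variables (R : realType) (m : nat) (C : css_code).
Hypotheses (hm : (2 <= m)%N) (hC : proper_css m C).
Implicit Types p q : R.

Let n : R := (len C)%:R.
Let k : R := code_dim R C.
Let c : R := 1 - 4 / m%:R.
Let mean_rank p : R := expect p (@rank_sum R C).

Lemma nb_rows r l (H : 'M['F_2]_(r, l)) : type2 H m -> (r * m = 2 * l)%N.
Proof.
case=> row_deg col_deg.
transitivity (\sum_(i < r) \sum_(j < l) (H i j == 1%R))%N.
  rewrite -[in LHS](card_ord r) -sum_nat_const; apply: eq_bigr => i _.
  by rewrite -(row_deg i) -sum1_card big_mkcond.
rewrite exchange_big /= mulnC -[in RHS](card_ord l) -sum_nat_const.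
apply: eq_bigr => j _; apply: etrans (col_deg j).
by rewrite -sum1_card [RHS]big_mkcond.
Qed.

Let m_gt0 : 0 < m%:R :> R. Proof. by rewrite ltr0n ltnW. Qed.

Let nb_rowsE r (H : 'M['F_2]_(r, len C)) : type2 H m -> r%:R = 2 / m%:R * n :> R.
Proof.
move=> /nb_rows/(congr1 (fun i => i%:R : R)); rewrite !natrM => e.
by rewrite mulrAC -e mulfK ?gt_eqF.
Qed.

Lemma rank_sumT : @rank_sum R C [set: 'I_(len C)] = n - k.
Proof. by rewrite /rank_sum !col_rankT /k /code_dim; lra. Qed.

(** Each matrix has [2 * n / m] rows and a rank smaller by at least one; these two units make
    [code_dim_gt0] strict even when [c = 0]. *)
Lemma code_dim_ge : c * n + 2 <= k.
Proof.
have [[tX tZ] [rX _] [rZ _] _ _] := hC.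
have ltR a b : (a < b)%N -> a%:R + 1 <= b%:R :> R by rewrite natr1 ler_nat.
have := ltR _ _ (rank_incidence_lt tX.2 rX); have := ltR _ _ (rank_incidence_lt tZ.2 rZ).
rewrite (nb_rowsE tX) (nb_rowsE tZ) /c /k /code_dim -/n => hX hZ.
have -> : 4 / m%:R = 2 / m%:R + 2 / m%:R :> R by rewrite -mulrDl; congr (_ / _); lra.
lra.
Qed.

(** The point [1 - (1 - p) * t] is [t * p + (1 - t) * 1], and the value at 1 is [n - k]. *)
Lemma mean_rank_concave p t : 0 <= p <= 1 -> 0 <= t <= 1 ->
  t * mean_rank p + (1 - t) * (n - k) <= mean_rank (1 - (1 - p) * t).
Proof.
move=> p01 t01; have t01' : 0 <= 1 - t <= 1 by lra.
rewrite -rank_sumT -[in leRHS](subKr 1 t) -{1}(subKr 1 t).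
exact: (expect_submodular_concave p01 t01'
  (submodularD (col_rank_submodular R (HX C)) (col_rank_submodular R (HZ C)))).
Qed.

Lemma mean_rank_ge p : 0 <= p <= 1 -> p * (n - k) <= mean_rank p.
Proof.
move=> p01; have r01 : 0 <= (0 : R) <= 1 by rewrite lexx ler01.
have t01 : 0 <= 1 - p <= 1 by lra.
have s0 : 0 <= mean_rank 0.
  rewrite -[leLHS](expect_cst 'I_(len C) (0 : R)); apply: le_expect => // A.
  by rewrite addr_ge0.
have := mean_rank_concave r01 t01; rewrite subr0 mul1r subKr => h.
by apply: le_trans h; rewrite lerDr mulr_ge0 //; lra.
Qed.

Lemma mean_rank_le p : 0 <= p <= 1 ->
  mean_rank p <= n * (4 / m%:R *
    (1 - (1 - p) ^+ m * S_poly m (m - 2) (p * (1 - p) ^+ (m - 2)))).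
Proof.
move=> p01; have [[tX tZ] _ _ [_ gX] [_ gZ]] := hC.
have hX := expect_rank_le hm tX.1 tX.2 gX p01.
have hZ := expect_rank_le hm tZ.1 tZ.2 gZ p01.
rewrite /mean_rank (expectD p (fun A => (col_rank (HX C) A)%:R)
  (fun A => (col_rank (HZ C) A)%:R)).
apply: le_trans (lerD hX hZ) _; rewrite (nb_rowsE tX) (nb_rowsE tZ).
by rewrite le_eqVlt; apply/orP; left; apply/eqP; ring.
Qed.

(** At 1/2 the two expected ranks cancel and the expected [logical_dim] is [k]; it can only grow
    with [p]. *)
Lemma Perr_ge_quarter p : 1 / 2 <= p <= 1 -> 0 < k -> 1 / 4 <= Perr C p.
Proof.
move=> /andP[p2 p1] k0; have h01 : 0 <= p <= 1 by lra.
have h2 : 0 <= (1 / 2 : R) <= p by lra.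
have := le_trans (expect_homo h2 p1 (@logical_dim_homo R C))
  (expect_logical_dim_le_Perr C h01).
rewrite expect_logical_dim rank_sumT.
have -> : 1 - 1 / 2 = 1 / 2 :> R by lra.
rewrite -/n -/k addrK => h.
rewrite -(ler_pM2l k0); lra.
Qed.

Variable ps : R.
Let W : R := 1 - (1 - ps) ^+ m * S_poly m (m - 2) (ps * (1 - ps) ^+ (m - 2)).
Hypotheses (ps_gt0 : 0 < ps) (ps_le : ps <= 1 / 2)
  (ps_eq : c = (1 - 2 * ps) * (4 / (m%:R * ps) * W - 1)).

Let ps_eq' : c * ps = (1 - 2 * ps) * (4 / m%:R * W - ps).
Proof.
rewrite ps_eq; field.
by rewrite !gt_eqF.
Qed.

(* If [k <= 0] then [c < 0], and concavity of [mean_rank] on [[0, 1]] already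
   contradicts the equation; no solution [ps] exists then. *)
Lemma code_dim_gt0 : 0 < k.
Proof.
have [ps0 ps2] := conj ps_gt0 ps_le.
have ps01 : 0 <= ps <= 1 by lra.
rewrite ltNge; apply/negP => k0.
have n0 : 0 <= n by rewrite ler0n.
have cn : c * n < 0 by have := code_dim_ge; lra.
have c0 : c < 0.
  by rewrite ltNge; apply/negP => c0; move: cn; rewrite ltNge mulr_ge0.
have n_gt0 : 0 < n.
  by rewrite lt_def n0 andbT; apply: contraTneq cn => ->; rewrite mulr0 ltxx.
have := le_trans (mean_rank_ge ps01) (mean_rank_le ps01); rewrite -/W => h.
have : ps * n <= n * (4 / m%:R * W).
  by apply: le_trans h; rewrite ler_wpM2l ?(ltW ps_gt0) //; lra.
rewrite mulrC ler_pM2l // => hW.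
have : 0 <= c * ps by rewrite ps_eq' mulr_ge0 //; lra.
by rewrite pmulr_lge0 // leNgt c0.
Qed.

(* [h1] and [h2] are concavity between [p], [1 - p], [1] and between [1 - p],
   [1 - ps], [1]. *)
Lemma Perr_tradeoff p : ps < p -> p < 1 / 2 ->
  (1 - 4 * Perr C p) * (1 + ps / (1 - 2 * p)) <= 1 + ps / (1 - 2 * ps).
Proof.
move=> psp p2; have [ps0 ps2] := conj ps_gt0 ps_le.
have k0 := code_dim_gt0; set eps := Perr C p.
have p01 : 0 <= p <= 1 by lra.
have p0 : 0 < p by lra.
have ps01 : 0 <= ps <= 1 by lra.
have d0 : 0 < 1 - 2 * p by lra.
have ds0 : 0 < 1 - 2 * ps by lra.
have hp : expect p (@logical_dim R C) <= 4 * k * eps by apply: expect_logical_dim_le_Perr.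
have hps : expect ps (@logical_dim R C) <= 4 * k * eps.
  by apply: le_trans hp; apply: expect_homo (@logical_dim_homo R C); lra.
move: hp hps; rewrite !expect_logical_dim rank_sumT -/n -!/(mean_rank _) => hp hps.
have hW := mean_rank_le ps01; rewrite -/W in hW.
have h1 : (1 - p) * (n - k - mean_rank (1 - p)) <= p * (n - k - mean_rank p).
  (* Chosen so that [1 - (1 - p) * t] is [1 - p]. *)
  pose t := p / (1 - p); have p10 : 0 < 1 - p by lra.
  have t01 : 0 <= t <= 1 by rewrite /t divr_ge0 ?ler_pdivrMr /=; lra.
  have tE : (1 - p) * t = p by rewrite mulrC divfK ?gt_eqF.
  have := mean_rank_concave p01 t01; rewrite tE => /(ler_wpM2l (ltW p10)).
  have := congr1 ( *%R^~ (mean_rank p)) tE; have := congr1 ( *%R^~ (n - k)) tE.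
  move: (mean_rank p) (mean_rank (1 - p)) => /= a b; lra.
have h2 : p * (n - k - mean_rank (1 - ps)) <= ps * (n - k - mean_rank (1 - p)).
  pose t := ps / p; have q01 : 0 <= 1 - p <= 1 by lra.
  have t01 : 0 <= t <= 1 by rewrite /t divr_ge0 ?ler_pdivrMr /=; lra.
  have tE : p * t = ps by rewrite mulrC divfK ?gt_eqF.
  have := mean_rank_concave q01 t01; rewrite subKr tE => /(ler_wpM2l (ltW p0)).
  have := congr1 ( *%R^~ (mean_rank (1 - p))) tE; have := congr1 ( *%R^~ (n - k)) tE.
  move: (mean_rank (1 - p)) (mean_rank (1 - ps)) => /= a b; lra.
pose x := (1 - 2 * p)^-1; pose y := (1 - 2 * ps)^-1.
have W_eq : 4 / m%:R * W = ps + c * ps * y.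
  by rewrite ps_eq' /y; field; rewrite !gt_eqF.
have cn : c * n <= k by have := code_dim_ge; lra.
(* Eliminates [mean_rank p] between [hp] and [h1]. *)
have a_le : n - k - mean_rank (1 - p) <= p * (n - (1 - 4 * eps) * k * x).
  rewrite -(ler_pM2l d0).
  have -> : (1 - 2 * p) * (p * (n - (1 - 4 * eps) * k * x))
      = p * ((1 - 2 * p) * n - (1 - 4 * eps) * k).
    by rewrite /x; field; rewrite gt_eqF.
  have := ler_wpM2l (ltW p0) hp; lra.
have as_le : n - k - mean_rank (1 - ps) <= ps * (n - (1 - 4 * eps) * k * x).
  rewrite -(ler_pM2l p0); apply: le_trans h2 _.
  by rewrite mulrCA ler_pM2l.
(* Inserting [as_le] and [hW] into [hps] cancels [2 * ps * n]; the remaining term [c * n * (ps * y)]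
   is compared with [k] through [cn]. *)
rewrite W_eq in hW; rewrite -(ler_pM2l k0) -/x -/y.
have : c * n * (ps * y) <= k * (ps * y).
  by rewrite ler_wpM2r // mulr_ge0 ?invr_ge0 ?ltW.
lra.
Qed.

End ProperCode.

(** * The bound on the erasure threshold *)

Unset Implicit Arguments.

Theorem theorem5p1 (R : realType) (m : nat) (hm : (2 <= m)%N)
    (pstar : R) (hp_range : 0 <= pstar <= 1 / 2%:R) (hp_neq0 : pstar <> 0)
    (hp_eq : 1 - 4%:R / m%:R =
       (1 - 2%:R * pstar) *
       (4%:R / (m%:R * pstar) *
          (1 - (1 - pstar) ^+ m *
               S_poly m (m - 2) (pstar * (1 - pstar) ^+ (m - 2))) - 1))
    (C : nat -> css_code) (hC : forall i : nat, proper_css m (C i)) :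
  erasure_threshold R C <= pstar.
Proof.
have [ps0 ps2] := andP hp_range.
have ps_gt0 : 0 < pstar by rewrite lt_def ps0 andbT; apply/eqP.
rewrite /erasure_threshold; set E := [set p : R | _]%classic.
(* The supremum of an empty set is 0 by convention. *)
have [E0|E0] := pselect (E !=set0)%classic; last by rewrite sup_out // => -[].
apply: ge_sup => // p [p01 cvP]; rewrite leNgt; apply/negP => psp.
have k_gt0 i : 0 < code_dim R (C i) by apply: code_dim_gt0 hp_eq => //; lra.
(* A positive lower bound uniform in [i] contradicts convergence to 0. *)
suff [d d0 hd] : exists2 d, 0 < d & forall i, d <= Perr (C i) p.
  have [N _ /(_ N (leqnn N))] := cvgr_lt _ cvP _ d0.
  by rewrite /= ltNge hd.
have [p2|p2] := lerP (1 / 2) p.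
  by exists (1 / 4) => [|i]; [lra|apply: Perr_ge_quarter => //; lra].
have tradeoff i := Perr_tradeoff hm (hC i) ps_gt0 ps2 hp_eq psp p2.
pose x := pstar / (1 - 2 * p); pose y := pstar / (1 - 2 * pstar).
have yx : y < x by rewrite ltr_pM2l // ltf_pV2 ?posrE; lra.
have y0 : 0 < y by rewrite divr_gt0 //; lra.
exists ((1 - (1 + y) / (1 + x)) / 4) => [|i].
  have : (1 + y) / (1 + x) < 1 by rewrite ltr_pdivrMr; lra.
  lra.
have := tradeoff i; rewrite -/x -/y -ler_pdivlMr; lra.
Qed.
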